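(* Let $R$ be a commutative ring and let $V$ be an $\mathrm{FI}$-module over $R$. Then for every $a\in\mathbb{N}$ there is an isomorphism of $\mathrm{FI}$-modules \[ H^{\mathrm{FI}}_a(V)\;\cong\; H_a(\widetilde{S}_{-*}V). \]
   Context: Let $R$ be a commutative ring. $\mathrm{FI}$ denotes the category of finite sets and injective maps; an $\mathrm{FI}$-module is a covariant functor from $\mathrm{FI}$ to the category of $R$-modules. For $n\in\mathbb{N}$, $[n]=\{1,\dots,n\}$ (so $[0]=\emptyset$). Let $A=\bigoplus_{0\le m\le n}A_{m,n}$, where $A_{m,n}$ is the free $R$-module on $\mathrm{Hom}_{\mathrm{FI}}([m],[n])$, made into a non-unital $R$-algebra by setting, for $\alpha\in\mathrm{Hom}_{\mathrm{FI}}([m],[n])$ and $\beta\in\mathrm{Hom}_{\mathrm{FI}}([r],[s])$, $\alpha\beta=\alpha\circ\beta$ if $s=m$ and $\alpha\beta=0$ otherwise. Let $J=\bigoplus_{0\le m<n}A_{m,n}$, a two-sided ideal, and let $e_n\in A_{n,n}$ be the identity of $[n]$. A left $A$-module $M$ is graded if $M=\bigoplus_n e_nM$. The functor $V\mapsto\bigoplus_{n}V([n])$ is an equivalence from $\mathrm{FI}$-modules to graded left $A$-modules, and we identify the two notions. The $\mathrm{FI}$-homology $H^{\mathrm{FI}}_a$ is the $a$-th left derived functor of the right exact functor $V\mapsto V/JV$ (from $\mathrm{FI}$-modules to $\mathrm{FI}$-modules), i.e. $H^{\mathrm{FI}}_a(V)=\mathrm{Tor}^A_a(A/J,V)$. The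 complex $\widetilde{S}_{-*}V$: for a finite set $I$, $RI$ is the free $R$-module on $I$ and $\det(I)=\bigwedge^{|I|}RI$ (so $\det(\emptyset)=R$). For an $\mathrm{FI}$-module $V$, a finite set $X$, $T\subset X$, $i\in X\setminus T$ and $v\in V(T)$, write $i(v)=\iota(v)\in V(T\cup\{i\})$, where $\iota:T\to T\cup\{i\}$ is the inclusion. For $a\in\mathbb{N}$ put \[(\widetilde{S}_{-a}V)(X)=\bigoplus_{I\subset X,\ |I|=a}V(X\setminus I)\otimes_R\det(I).\] The differential $d:(\widetilde{S}_{-a}V)(X)\to(\widetilde{S}_{-a+1}V)(X)$ is given by $d(v\otimes i_1\wedge\cdots\wedge i_a)=\sum_{p=1}^a(-1)^p\, i_p(v)\otimes i_1\wedge\cdots\widehat{i_p}\cdots\wedge i_a$ for $v\in V(X\setminus I)$, $I=\{i_1,\dots,i_a\}$. For an injection $\alpha:X\to X'$, $\alpha(v\otimes i_1\wedge\cdots\wedge i_a)=\alpha(v)\otimes\alpha(i_1)\wedge\cdots\wedge\alpha(i_a)$ with $\alpha(v)\in V(X'\setminus\alpha(I))$ (the image of $v$ under the restriction of $\alpha$ to $X\setminus I\to X'\setminus\alpha(I)$). This makes each $\widetilde{S}_{-a}V$ an $\mathrm{FI}$-module and $\cdots\to\widetilde{S}_{-2}V\to\widetilde{S}_{-1}V\to\widetilde{S}_0V\to0$ a complex of $\mathrm{FI}$-modules, whose homology $H_a(\widetilde{S}_{-*}V)$ (taken at $\widetilde{S}_{-a}V$) is an $\mathrm{FI}$-module. 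*)

(* Defs.v *)
(* FI-modules over a commutative ring, modelled on the
   skeleton of FI (objects [n] = {0,...,n-1}). *)
From HB Require Import structures.
From mathcomp Require Import all_boot all_order all_algebra.
Set Implicit Arguments. Unset Strict Implicit. Unset Printing Implicit Defensive.
Import Order.TTheory GRing.Theory.
Local Open Scope ring_scope.

Section FI.
Variable R : comPzRingType.

(* f : nat -> nat represents a morphism [m] -> [n] of FI (only its values on
   0..m-1 matter): it maps [m] into [n] injectively. *)
Definition fi_inj (m n : nat) (f : nat -> nat) : Prop :=
  (forall i, (i < m)%N -> (f i < n)%N) /\
  (forall i j, (i < m)%N -> (j < m)%N -> f i = f j -> i = j).

Record FIpre := {
  car : nat -> lmodType R;
  act : forall m n, (nat -> nat) -> car m -> car n }.

Record FImod := {
  fipre : FIpre;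
  act_lin : forall m n f, fi_inj m n f -> forall (r : R) (x y : car fipre m),
      @act fipre m n f (r *: x + y) = r *: @act fipre m n f x + @act fipre m n f y;
  act_ext : forall m n f g, (forall i, (i < m)%N -> f i = g i) ->
      forall x : car fipre m, @act fipre m n f x = @act fipre m n g x;
  act_id : forall m (x : car fipre m), @act fipre m m id x = x;
  act_comp : forall l m n f g, fi_inj l m f -> fi_inj m n g ->
      forall x : car fipre l, @act fipre l n (g \o f) x = @act fipre m n g (@act fipre l m f x) }.

Definition Mc (M : FImod) n := car (fipre M) n.
Definition Ma (M : FImod) m n f : Mc M m -> Mc M n := @act (fipre M) m n f.

Record FIhom (M N : FImod) := {
  hmap : forall n, Mc M n -> Mc N n;
  hlin : forall n (r : R) x y, @hmap n (r *: x + y) = r *: @hmap n x + @hmap n y;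
  hnat : forall m n f, fi_inj m n f ->
      forall x, @hmap n (@Ma M m n f x) = @Ma N m n f (@hmap m x) }.
Arguments hmap {M N} f0 n _.

Definition FIprojective (P : FImod) : Prop :=
  forall (M N : FImod) (g : FIhom M N) (h : FIhom P N),
    (forall n (y : Mc N n), exists x, hmap g n x = y) ->
    exists k : FIhom P M, forall n x, hmap g n (hmap k n x) = hmap h n x.

Definition is_proj_resolution (V : FImod) (P : nat -> FImod)
    (dP : forall a, FIhom (P a.+1) (P a)) (eps : FIhom (P 0%N) V) : Prop :=
  (forall a, FIprojective (P a)) /\
  (forall n (y : Mc V n), exists x, hmap eps n x = y) /\
  (forall n (x : Mc (P 0%N) n), hmap eps n x = 0 <-> exists y, hmap (dP 0%N) n y = x) /\
  (forall a n (x : Mc (P a.+1) n), hmap (dP a) n x = 0 <-> exists y, hmap (dP a.+1) n y = x).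

Inductive inJ (M : FIpre) (n : nat) : car M n -> Prop :=
  | inJ0 : inJ (0 : car M n)
  | inJadd x y : inJ x -> inJ y -> inJ (x + y)
  | inJscale (r : R) x : inJ x -> inJ (r *: x)
  | inJgen m f (y : car M m) : (m < n)%N -> fi_inj m n f -> inJ (@act M m n f y).

(* A subquotient K/L of (the underlying data of) an FI-module; the FI-module
   structure on K/L is the one induced by the action on M. *)
Record SQ := { sq_mod : FIpre;
               sq_K : forall n, car sq_mod n -> Prop;
               sq_L : forall n, car sq_mod n -> Prop }.
Arguments sq_K s {n} _ : rename.
Arguments sq_L s {n} _ : rename.

(* Isomorphism of FI-modules K_A/L_A ~= K_B/L_B, given by representatives:
   phi induces a well-defined, R-linear, FI-equivariant bijection. *)
Definition SQ_iso (A B : SQ) : Prop :=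
  exists phi : forall n, car (sq_mod A) n -> car (sq_mod B) n,
  (forall n x, sq_K A x -> sq_K B (phi n x)) /\
  (forall n (r : R) x y, sq_K A x -> sq_K A y ->
       sq_L B (phi n (r *: x + y) - (r *: phi n x + phi n y))) /\
  (forall n x, sq_L A x -> sq_L B (phi n x)) /\
  (forall n x, sq_K A x -> sq_L B (phi n x) -> sq_L A x) /\
  (forall n y, sq_K B y -> exists x, sq_K A x /\ sq_L B (phi n x - y)) /\
  (forall m n f x, fi_inj m n f -> sq_K A x ->
       sq_L B (phi n (@act (sq_mod A) m n f x) - @act (sq_mod B) m n f (phi m x))).

(* H^FI_a(V) = Tor^A_a(A/J, V) = H_a(P/JP) for a projective resolution P. *)
Definition FIhomK (P : nat -> FImod) (dP : forall a, FIhom (P a.+1) (P a))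
    (a n : nat) : Mc (P a) n -> Prop :=
  match a as a0 return Mc (P a0) n -> Prop with
  | 0%N => fun _ => True
  | a'.+1 => fun x => inJ (hmap (dP a') n x)
  end.

Definition FIhomology (P : nat -> FImod) (dP : forall a, FIhom (P a.+1) (P a))
    (a : nat) : SQ :=
  {| sq_mod := fipre (P a);
     sq_K := fun n x => FIhomK dP x;
     sq_L := fun n x => exists y z, @inJ (fipre (P a)) n z /\ x = hmap (dP a) n y + z |}.

(* ---- The complex tilde S V, written on the skeleton ----
   (\tilde S_{-a} V)([n]) = (+)_{I subset [n], |I| = a} V([n] \ I) (x) det(I),
   where [n] \ I is identified with [n-a] by the increasing bijection and
   det(I) with R via the basis i_1 /\ ... /\ i_a, i_1 < ... < i_a. *)

Definition ksub (n a : nat) := {I : {set 'I_n} | #|I| == a}.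

Definition cemb n (I : {set 'I_n}) (k : nat) : nat :=
  nth 0%N [seq val i | i <- enum (~: I)] k.
Definition cidx n (I : {set 'I_n}) (x : nat) : nat :=
  index x [seq val i | i <- enum (~: I)].

Definition fimg n n' (f : nat -> nat) (I : {set 'I_n}) : {set 'I_n'} :=
  [set j : 'I_n' | [exists i in I, f (val i) == val j]].

(* sign of the permutation sorting (f i_1, ..., f i_a) *)
Definition sgn_inv n (f : nat -> nat) (I : {set 'I_n}) : R :=
  (-1) ^+ #|[set p in setX I I | (val p.1 < val p.2)%N && (f (val p.2) < f (val p.1))%N]|.

(* position (1-based) in I of the unique element of I \ I' *)
Definition dpos n (I I' : {set 'I_n}) : nat :=
  #|[set j in I | [exists i in I :\: I', (val j <= val i)%N]]|.

Variable V : FImod.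

Definition Sc (a n : nat) : lmodType R := {ffun ksub n a -> Mc V (n - a)}.

Definition Sact (a n n' : nat) (f : nat -> nat) (v : Sc a n) : Sc a n' :=
  [ffun J : ksub n' a =>
     \sum_(I : ksub n a | fimg n' f (val I) == val J)
        sgn_inv f (val I) *:
          @Ma V (n - a) (n' - a) (fun k => cidx (val J) (f (cemb (val I) k))) (v I)].

Definition Stilde (a : nat) : FIpre := {| car := Sc a; act := @Sact a |}.

Definition Sd (a n : nat) (v : Sc a.+1 n) : Sc a n :=
  [ffun I' : ksub n a =>
     \sum_(I : ksub n a.+1 | val I' \subset val I)
        (-1) ^+ dpos (val I) (val I') *:
          @Ma V (n - a.+1) (n - a) (fun k => cidx (val I') (cemb (val I) k)) (v I)].

Definition SK (a n : nat) : Sc a n -> Prop :=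
  match a as a0 return Sc a0 n -> Prop with
  | 0%N => fun _ => True
  | a'.+1 => fun x => Sd x = 0
  end.

Definition Stilde_homology (a : nat) : SQ :=
  {| sq_mod := Stilde a;
     sq_K := fun n x => SK x;
     sq_L := fun n x => exists y : Sc a.+1 n, Sd y = x |}.

End FI.

(* Main.v *)
Require Import Defs.
From HB Require Import structures.
From mathcomp Require Import all_boot all_order all_algebra.
From mathcomp Require Import boolp.

(* Everything happens in the double complex S_p(P_q), where S is the complex of
   the statement and P_* the given projective resolution of V.  The functor S_p
   is exact (it is a finite product of evaluations), so the rows resolve S_p V.
   The columns resolve P_q/JP_q.  For this, cover a projective P by an FI-module
   Q on which also partial injections act (Q_n is a product of copies of the V_m
   indexed by sequences in [n]); P is a retract of Q.  On S_*(Q)([n]) each i in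
   [n] gives a homotopy "restrict from X \ I to X \ (I u {i}), then wedge with
   i", and subtracting its boundary from a cycle kills the components at all I
   containing i, without destroying what was achieved for other elements of [n].
   Instead of the total complex, the two homologies are compared by moving along
   the antidiagonal one square at a time, matching z in S_p(P_(q+1)) with
   z' in S_(p+1)(P_q) when they have the same image in S_p(P_q). *)

Set Implicit Arguments. Unset Strict Implicit. Unset Printing Implicit Defensive.
Import GRing.Theory.
Local Open Scope ring_scope.

(** * Isomorphisms of subquotients *)

Section SubquotientRelations.
Variable R : comPzRingType.

Arguments sq_K {R} s {n} _.
Arguments sq_L {R} s {n} _.

(** An isomorphism of subquotients presented as a linear equivariant correspondence. No
    representatives have to be chosen, so the links of a zigzag compose directly; choice enters only
    once, in [SQ_rel_iso]. *)
Definition SQ_rel (A B : SQ R) : Prop :=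
  exists r : forall n, car (sq_mod A) n -> car (sq_mod B) n -> Prop,
    [/\ (forall n x y, r n x y -> sq_K A x /\ sq_K B y),
        (forall n (c : R) x y x' y', r n x y -> r n x' y' ->
           r n (c *: x + x') (c *: y + y')),
        (forall m n f x y, fi_inj m n f -> r m x y ->
           r n (act n f x) (act n f y)),
        (forall n x, sq_K A x -> exists y, r n x y)
      & (forall n y, sq_K B y -> exists x, r n x y)] /\
    (forall n x y, r n x y -> (sq_L A x <-> sq_L B y)).

Lemma SQ_rel_trans (A B C : SQ R) : SQ_rel A B -> SQ_rel B C -> SQ_rel A C.
Proof.
move=> [r [[rK rlin ract rtot rsurj] rL]] [s [[sK slin sact stot ssurj] sL]].
exists (fun n x z => exists2 y, r n x y & s n y z); split; first split.
- by move=> n x z [y /rK[Kx _] /sK[_ Kz]].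
- move=> n c x z x' z' [y rxy syz] [y' rxy' syz'].
  by exists (c *: y + y'); [apply: rlin | apply: slin].
- move=> m n f x z fI [y rxy syz].
  by exists (act n f y); [apply: ract | apply: sact].
- move=> n x /rtot[y rxy]; have [_ /stot[z syz]] := rK _ _ _ rxy.
  by exists z, y.
- move=> n z /ssurj[y syz]; have [/rsurj[x rxy] _] := sK _ _ _ syz.
  by exists x, y.
- by move=> n x z [y /rL rxy /sL syz]; split=> [/rxy/syz|/syz/rxy].
Qed.

(** Two elements related to the same [x] differ by one related to 0, hence by an element of [L]. So
    any choice function for the correspondence is linear and equivariant modulo [L]. *)
Lemma SQ_rel_iso (A B : SQ R) :
  (forall n (x : car (sq_mod A) n), sq_L A x -> sq_K A x) ->
  (forall n, sq_L A (0 : car (sq_mod A) n)) ->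
  SQ_rel A B -> SQ_iso A B.
Proof.
move=> LK L0 [r [[rK rlin ract rtot rsurj] rL]].
have phi_ex n (x : car (sq_mod A) n) : exists y, sq_K A x -> r n x y.
  case: (pselect (sq_K A x)) => [/rtot[y rxy]|nKx]; first by exists y.
  (* Outside [K] any value will do: the conditions of [SQ_iso] concern elements of [K], or of [L],
     which lies in [K] by [LK]. *)
  by exists 0.
pose phi n x := projT1 (cid (phi_ex n x)).
have phiP n x : sq_K A x -> r n x (phi n x) by exact: projT2 (cid (phi_ex n x)).
have rlinN n x y x' y' : r n x y -> r n x' y' -> r n (x - x') (y - y').
  move=> rxy rxy'; rewrite [x - _]addrC [y - _]addrC -!scaleN1r.
  exact: rlin.
have diffL n x y y' : r n x y -> r n x y' -> sq_L B (y - y').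
  move=> rxy /(rlinN _ _ _ _ _ rxy) H.
  by apply/(rL _ _ _ H); rewrite subrr.
exists phi; split; last split; last split; last split; last split.
- by move=> n x /phiP/rK[].
- move=> n c x y Kx Ky; have rc := rlin _ c _ _ _ _ (phiP _ _ Kx) (phiP _ _ Ky).
  by apply: diffL (rc); apply: phiP; have [] := rK _ _ _ rc.
- by move=> n x Lx; apply/(rL _ _ _ (phiP _ _ (LK _ _ Lx))).
- by move=> n x /phiP/rL H /H.
- move=> n y /rsurj[x rxy]; have [Kx _] := rK _ _ _ rxy.
  by exists x; split=> //; apply: diffL rxy; apply: phiP.
- move=> m n f x fI /phiP/(ract _ _ _ _ _ fI) H.
  by apply: diffL (H); apply: phiP; have [] := rK _ _ _ H.
Qed.

End SubquotientRelations.

(** * The complex of an FI-module *)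

Section Linear.

Lemma big_inj (A B : finType) (W : nmodType) (PA : pred A) (PB : pred B)
    (h : A -> B) (F : B -> W) :
  {in PA &, injective h} -> (forall a, PA a -> PB (h a)) ->
  (forall b, PB b -> (forall a, PA a -> h a != b) -> F b = 0) ->
  \sum_(b | PB b) F b = \sum_(a | PA a) F (h a).
Proof.
move=> hI hP hF; rewrite -(big_imset F hI) /= big_mkcond [RHS]big_mkcond /=.
apply: eq_bigr => b _; case: imsetP => [[a Pa ->]|nb]; first by rewrite hP.
case: ifP => // Pb; apply: hF => // a Pa.
by apply/eqP => E; apply: nb; exists a.
Qed.

Variables (R : pzRingType) (U W : lmodType R) (phi : U -> W).
Hypothesis phi_lin : linear phi.
HB.instance Definition _ := GRing.isLinear.Build R U W *:%R phi phi_lin.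

Lemma lin0 : phi 0 = 0. Proof. exact: linear0. Qed.
Lemma linZ c x : phi (c *: x) = c *: phi x. Proof. exact: linearZ. Qed.
Lemma linB x y : phi (x - y) = phi x - phi y. Proof. exact: linearB. Qed.
Lemma linD x y : phi (x + y) = phi x + phi y. Proof. exact: linearD. Qed.
Lemma lin_sum (I : finType) (P : pred I) (F : I -> U) :
  phi (\sum_(i | P i) F i) = \sum_(i | P i) phi (F i).
Proof. exact: linear_sum. Qed.

End Linear.

(** * Complements of subsets and the maps between them *)

Section Transport.

Section Index.
Variables (n : nat) (I : {set 'I_n}).
Let s := [seq val i | i <- enum (~: I)].
Let s_uniq : uniq s.
Proof. by rewrite map_inj_uniq ?enum_uniq //; apply: val_inj. Qed.
Let s_size : size s = (n - #|I|)%N.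
Proof.
have := cardsC I; rewrite card_ord size_map -cardE => E.
by apply: (@addnI #|I|); rewrite E subnKC //; have := max_card I; rewrite card_ord.
Qed.

Lemma cidx_lt (i : 'I_n) : i \notin I -> (cidx I i < n - #|I|)%N.
Proof.
move=> iI; rewrite -s_size index_mem mem_map ?mem_enum ?inE //; exact: val_inj.
Qed.

Lemma cidxK (i : 'I_n) : i \notin I -> cemb I (cidx I i) = i.
Proof.
move=> iI; apply: nth_index; rewrite mem_map ?mem_enum ?inE //; exact: val_inj.
Qed.

Lemma cembK k : (k < n - #|I|)%N -> cidx I (cemb I k) = k.
Proof. by rewrite -s_size => kI; apply: index_uniq. Qed.

Lemma cembP k : (k < n - #|I|)%N -> exists2 i : 'I_n, i \notin I & val i = cemb I k.
Proof.
rewrite -s_size => kI; have /mapP[i] : cemb I k \in s by apply: mem_nth.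
by rewrite mem_enum inE => iI ->; exists i.
Qed.
End Index.

Definition tmap n n' (I : {set 'I_n}) (J : {set 'I_n'}) (f : nat -> nat) : nat -> nat :=
  fun k => cidx J (f (cemb I k)).

Definition maps_compl n n' (f : nat -> nat) (I : {set 'I_n}) (J : {set 'I_n'}) :=
  (forall i : 'I_n, i \notin I -> exists2 j : 'I_n', j \notin J & val j = f i) /\
  (forall i j : 'I_n, i \notin I -> j \notin I -> f i = f j -> i = j).

Lemma tmap_inj n n' f (I : {set 'I_n}) (J : {set 'I_n'}) :
  maps_compl f I J -> fi_inj (n - #|I|) (n' - #|J|) (tmap I J f).
Proof.
move=> [fJ fI]; split=> [k /cembP[i iI Ei]|k l kI lI].
  by rewrite /tmap -Ei; have [j jJ <-] := fJ i iI; apply: cidx_lt.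
have [i iI Ei] := cembP kI; have [j jI Ej] := cembP lI.
rewrite /tmap -Ei -Ej; have [i' iJ Ei'] := fJ i iI; have [j' jJ Ej'] := fJ j jI.
move/(congr1 (cemb J)); rewrite -Ei' -Ej' !cidxK // Ei' Ej' => /(fI _ _ iI jI) E.
by rewrite -(cembK kI) -(cembK lI) -Ei -Ej E.
Qed.

Lemma maps_compl_sub n (I J : {set 'I_n}) : J \subset I -> maps_compl id I J.
Proof.
move=> /subsetP JI; split=> [i iI|i j _ _]; last exact: val_inj.
by exists i => //; apply: contra iI; apply: JI.
Qed.

Lemma mem_fimg n n' f (I : {set 'I_n}) (i : 'I_n) (j : 'I_n') :
  fi_inj n n' f -> val j = f i -> (j \in fimg n' f I) = (i \in I).
Proof.
move=> [_ fI] E; rewrite inE; apply/existsP/idP => [[k /andP[kI /eqP]]|iI].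
  by rewrite E => /fI/= H; rewrite -(val_inj (H (ltn_ord k) (ltn_ord i))).
by exists i; rewrite iI E /=.
Qed.

Lemma fi_ord n n' f : fi_inj n n' f ->
  exists2 h : 'I_n -> 'I_n', injective h & forall i, val (h i) = f i.
Proof.
move=> [fl fI]; exists (fun i : 'I_n => Ordinal (fl i (ltn_ord i))) => // i j [].
by move/fI => H; apply: val_inj; apply: H.
Qed.

Lemma fimgE n n' (f : nat -> nat) (h : 'I_n -> 'I_n') (I : {set 'I_n}) :
  (forall i, val (h i) = f i) -> fimg n' f I = h @: I.
Proof.
move=> hE; apply/setP => j; rewrite inE.
apply/existsP/imsetP => [[i /andP[iI /eqP E]]|[i iI ->]].
  by exists i => //; apply: val_inj; rewrite hE.
by exists i; rewrite iI hE /=.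
Qed.

Lemma card_fimg n n' f (I : {set 'I_n}) : fi_inj n n' f -> #|fimg n' f I| = #|I|.
Proof. by move=> /fi_ord[h hI hE]; rewrite (fimgE _ hE) card_imset. Qed.

Lemma maps_compl_fimg n n' f (I : {set 'I_n}) :
  fi_inj n n' f -> maps_compl f I (fimg n' f I).
Proof.
move=> fI; have [h hI hE] := fi_ord fI; split=> [i iI|i j _ _].
  by exists (h i); rewrite ?(mem_fimg _ fI (hE i)).
by rewrite -!hE => /val_inj/hI.
Qed.

Variables (R : comPzRingType).
Implicit Types M N : FImod R.

Lemma Ma_lin M m n f : fi_inj m n f -> linear (@Ma R M m n f).
Proof. by move=> fI c x y; apply: act_lin. Qed.

(* The map V([n] \ I) -> V([n'] \ J) induced by f, in the coordinates of
   Stilde; meant for #|I| = a and #|J| = b. *)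
Definition tr M n n' a b (I : {set 'I_n}) (J : {set 'I_n'}) f :
    Mc M (n - a) -> Mc M (n' - b) := @Ma R M (n - a) (n' - b) (tmap I J f).

Lemma tr_fi n n' a b (I : {set 'I_n}) (J : {set 'I_n'}) f :
  #|I| = a -> #|J| = b -> maps_compl f I J -> fi_inj (n - a) (n' - b) (tmap I J f).
Proof. by move=> <- <-; apply: tmap_inj. Qed.

Lemma tr_lin M n n' a b (I : {set 'I_n}) (J : {set 'I_n'}) f :
  #|I| = a -> #|J| = b -> maps_compl f I J -> linear (@tr M n n' a b I J f).
Proof. by move=> Ia Jb fIJ; apply: Ma_lin; apply: tr_fi. Qed.

(** The intermediate relabelling cancels: [f] sends the complement of [I] outside [J], where
    [cemb J] undoes [cidx J]. *)
Lemma tr_comp M n n' n'' a b c (I : {set 'I_n}) (J : {set 'I_n'}) (K : {set 'I_n''})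
    (f g h : nat -> nat) x : #|I| = a -> #|J| = b -> #|K| = c ->
  maps_compl f I J -> maps_compl g J K ->
  (forall i : 'I_n, i \notin I -> g (f i) = h i) ->
  @tr M n' n'' b c J K g (@tr M n n' a b I J f x) = tr c I K h x.
Proof.
move=> Ia Jb Kc fIJ gJK gf; rewrite /tr /Ma -act_comp; [|exact: tr_fi..].
apply: act_ext => k; rewrite -Ia => /cembP[i iI Ei].
rewrite /tmap/= -Ei; have [j jJ Ej] := fIJ.1 i iI.
by rewrite -gf // -Ej cidxK.
Qed.

Lemma tr_hmap M N (g : FIhom M N) n n' a b (I : {set 'I_n}) (J : {set 'I_n'}) f x :
  #|I| = a -> #|J| = b -> maps_compl f I J ->
  hmap g (@tr M n n' a b I J f x) = tr b I J f (hmap g x).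
Proof. by move=> Ia Jb fIJ; apply: hnat; apply: tr_fi. Qed.

End Transport.

(** * The differential in coordinates *)

Section Koszul.
Variable R : comPzRingType.
Implicit Types M N : FImod R.

(** Extension by 0 to sets of the wrong size allows sums over plain sets, with no cardinality proof
    inside the index. *)
Definition coef M a n (x : Sc M a n) (I : {set 'I_n}) : Mc M (n - a) :=
  if insub I is Some K then x K else 0.

Lemma coef_val M a n (x : Sc M a n) (K : ksub n a) : coef x (val K) = x K.
Proof. by rewrite /coef valK. Qed.

Lemma coef_out M a n (x : Sc M a n) (I : {set 'I_n}) : #|I| != a -> coef x I = 0.
Proof. by move=> Ia; rewrite /coef insubN. Qed.

Lemma coef_lin M a n (I : {set 'I_n}) : linear (fun x : Sc M a n => coef x I).
Proof.
move=> c x y; rewrite /coef; case: insubP => [K _ _|_]; first by rewrite !ffunE.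
by rewrite scaler0 addr0.
Qed.

Lemma coef_ext M a n (x y : Sc M a n) :
  (forall I : {set 'I_n}, #|I| = a -> coef x I = coef y I) -> x = y.
Proof.
by move=> E; apply/ffunP => K; rewrite -!coef_val; apply/E/eqP/(valP K).
Qed.

Definition mkS M a n (F : {set 'I_n} -> Mc M (n - a)) : Sc M a n :=
  [ffun K : ksub n a => F (val K)].

Lemma coef_mkS M a n F (I : {set 'I_n}) : #|I| = a -> coef (@mkS M a n F) I = F I.
Proof. by move/eqP => Ia; rewrite /coef insubT ffunE. Qed.

Definition Smap M N (g : FIhom M N) a n (x : Sc M a n) : Sc N a n :=
  [ffun K => hmap g (x K)].

Lemma hmap_lin M N (g : FIhom M N) n : linear (@hmap R M N g n).
Proof. exact: hlin. Qed.

Lemma coef_Smap M N (g : FIhom M N) a n (x : Sc M a n) I :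
  coef (Smap g x) I = hmap g (coef x I).
Proof.
rewrite /coef; case: insubP => [K _ _|_]; first by rewrite ffunE.
by rewrite (lin0 (@hmap_lin _ _ _ _)).
Qed.

Lemma Smap_lin M N (g : FIhom M N) a n : linear (@Smap M N g a n).
Proof. by move=> c x y; apply/ffunP => K; rewrite !ffunE hlin. Qed.

(* The sign of [k] in the differential from [k |: I] to [I], [k \notin I]. *)
Definition dsgn n (k : 'I_n) (I : {set 'I_n}) : R :=
  (-1) ^+ #|[set j in I | (j < k)%N]|.+1.

Lemma sum_ksub (W : nmodType) a n (Q : pred {set 'I_n}) (F : {set 'I_n} -> W) :
  \sum_(K : ksub n a | Q (val K)) F (val K) = \sum_(K : {set 'I_n} | (#|K| == a) && Q K) F K.
Proof.
symmetry; apply: big_inj => [K L _ _|K QK|K /andP[Ka QK] H]; first exact: val_inj.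
  by rewrite (valP K).
by have := H (Sub K Ka) QK; rewrite SubK eqxx.
Qed.

Lemma sum_setU1 (W : nmodType) a n (I : {set 'I_n}) (F : {set 'I_n} -> W) :
  #|I| = a ->
  \sum_(K : {set 'I_n} | (#|K| == a.+1) && (I \subset K)) F K =
    \sum_(k | k \notin I) F (k |: I).
Proof.
move=> Ia; apply: big_inj => [k l kI lI E|k kI|K /andP[Ka IK] H].
- by have := setU11 k I; rewrite E !inE (negPf kI) orbF => /eqP.
- by rewrite cardsU1 kI Ia eqxx subsetU1.
have [k] : exists k, k \in K :\: I.
  by apply/set0Pn; rewrite -card_gt0 cardsD (setIidPr IK) (eqP Ka) Ia subSn ?subnn.
rewrite inE => /andP[kI kK]; have := H k kI.
rewrite eqEcard subUset sub1set kK IK /= (eqP Ka) cardsU1 kI Ia.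
by rewrite leqnn.
Qed.

Lemma dpos_setU1 n (k : 'I_n) (I : {set 'I_n}) : k \notin I ->
  dpos (k |: I) I = #|[set j in I | (j < k)%N]|.+1.
Proof.
move=> kI; set S := [set j in k |: I | (j <= k)%N].
have -> : [set j in I | (j < k)%N] = S :\ k.
  apply/setP => j; rewrite !inE ltn_neqAle (inj_eq val_inj).
  by case: (j == k) => /=; rewrite ?andbF.
have -> : dpos (k |: I) I = #|S|.
  rewrite /dpos; congr #|pred_of_set _|; apply/setP => j; rewrite !inE; congr andb.
  apply/existsP/idP => [[i]|jk]; last by exists k; rewrite !inE kI eqxx.
  by rewrite !inE => /andP[/andP[/negPf->]]; rewrite orbF => /eqP->.
by rewrite (cardsD1 k S) !inE eqxx leqnn add1n.
Qed.

(** The supersets of [I] with one more element are the [k |: I], so the sum in [Sd] can run over the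
    added element; later computations with [Sd] use this form. *)
Lemma coef_Sd M a n (x : Sc M a.+1 n) (I : {set 'I_n}) : #|I| = a ->
  coef (Sd x) I =
  \sum_(k | k \notin I) dsgn k I *: tr a (k |: I) I id (coef x (k |: I)).
Proof.
move=> Ia; move/eqP: (Ia) => Iab; rewrite {1}/coef insubT ffunE /=.
pose F K := (-1) ^+ dpos K I *: tr a K I id (coef x K).
transitivity (\sum_(K : ksub n a.+1 | I \subset val K) F (val K)).
  by apply: eq_bigr => K _; rewrite /F coef_val.
rewrite (sum_ksub _ (fun K => I \subset K)) (sum_setU1 _ Ia).
by apply: eq_bigr => k kI; rewrite /F dpos_setU1.
Qed.

Lemma maps_compl_setU1 n (k : 'I_n) (I : {set 'I_n}) : maps_compl id (k |: I) I.
Proof. by apply: maps_compl_sub; apply: subsetU1. Qed.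

Lemma card_setU1 n a (k : 'I_n) (I : {set 'I_n}) :
  k \notin I -> #|I| = a -> #|k |: I| = a.+1.
Proof. by move=> kI <-; rewrite cardsU1 kI. Qed.

Lemma tr_setU1_lin M n a (k : 'I_n) (I : {set 'I_n}) : k \notin I -> #|I| = a ->
  linear (@tr R M n n a.+1 a (k |: I) I id).
Proof.
by move=> kI Ia; apply: tr_lin; [exact: card_setU1 | | exact: maps_compl_setU1].
Qed.

Lemma Sd_lin M a n : linear (@Sd R M a n).
Proof.
move=> c x y; apply: coef_ext => I Ia; rewrite coef_lin !coef_Sd //.
rewrite scaler_sumr -big_split /=; apply: eq_bigr => k kI.
rewrite coef_lin (tr_setU1_lin kI Ia).
by rewrite scalerDr !scalerA [c * _]mulrC.
Qed.

Lemma Sd_Smap M N (g : FIhom M N) a n (x : Sc M a.+1 n) :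
  Sd (Smap g x) = Smap g (Sd x).
Proof.
apply: coef_ext => I Ia; rewrite coef_Smap !coef_Sd // (lin_sum (@hmap_lin _ _ _ _)).
apply: eq_bigr => k kI; rewrite (linZ (@hmap_lin _ _ _ _)) coef_Smap.
by rewrite (tr_hmap _ _ (card_setU1 kI Ia) Ia) //; apply: maps_compl_setU1.
Qed.

Lemma dsgnU1 n (k l : 'I_n) (I : {set 'I_n}) : k \notin I ->
  dsgn l (k |: I) = (-1) ^+ (k < l)%N * dsgn l I.
Proof.
move=> kI; rewrite /dsgn -exprD addnS; congr (_ ^+ _.+1).
case: ltnP => kl.
  have -> : [set j in k |: I | (j < l)%N] = k |: [set j in I | (j < l)%N].
    by apply/setP => j; rewrite !inE; case: eqP => // ->; rewrite kl.
  by rewrite cardsU1 !inE (negPf kI).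
rewrite add0n; congr #|pred_of_set _|; apply/setP => j; rewrite !inE.
by case: eqP => // ->; rewrite (negPf kI) ltnNge kl.
Qed.

Lemma dsgn_sqr n (k : 'I_n) I : dsgn k I * dsgn k I = 1.
Proof. by rewrite -expr2 sqrr_sign. Qed.

(** Inserting one of two distinct elements moves the position of the other only if the inserted one
    is smaller; this happens for exactly one of the two orders. *)
Lemma dsgn_anti n (k l : 'I_n) (I : {set 'I_n}) : k \notin I -> l \notin I -> k != l ->
  dsgn k I * dsgn l (k |: I) = - (dsgn l I * dsgn k (l |: I)).
Proof.
move=> kI lI; rewrite !dsgnU1 // -(inj_eq val_inj) neq_ltn => /orP[] H.
  rewrite H ltnNge ltnW //= expr1 expr0.
  by rewrite mul1r mulN1r mulrN [dsgn k I * _]mulrC.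
rewrite H ltnNge ltnW //= expr1 expr0.
by rewrite mul1r mulN1r mulrN opprK mulrC.
Qed.

(** The double sum over pairs [k], [l] is split by which is larger. Swapping the two indices turns
    one half into the negative of the other by [dsgn_anti], as both orders use the same set and the
    same inclusion. *)
Lemma SdSd M a n (x : Sc M a.+2 n) : Sd (Sd x) = 0.
Proof.
apply: coef_ext => I Ia; rewrite (lin0 (@coef_lin _ _ _ _)) coef_Sd //.
pose F k l := (dsgn k I * dsgn l (k |: I)) *:
   tr a (k |: (l |: I)) I id (coef x (k |: (l |: I))).
have E : forall k, k \notin I ->
   dsgn k I *: tr a (k |: I) I id (coef (Sd x) (k |: I)) =
   \sum_(l | (l \notin I) && (l != k)) F k l.
  move=> k kI; rewrite coef_Sd ?(card_setU1 kI Ia) //.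
  rewrite (lin_sum (tr_setU1_lin kI Ia)).
  rewrite scaler_sumr; apply: eq_big => [l|l].
    by rewrite !inE negb_or andbC.
  rewrite !inE negb_or => /andP[lk lI].
  have lkI : l \notin k |: I by rewrite !inE negb_or lk.
  rewrite (linZ (tr_setU1_lin kI Ia)).
  rewrite scalerA /F [k |: (l |: I)]setUCA; congr (_ *: _).
  apply: (tr_comp (f := id) (g := id) (h := id)) => //.
  - by rewrite (card_setU1 lkI (card_setU1 kI Ia)).
  - exact: card_setU1.
  - exact: maps_compl_setU1.
  - exact: maps_compl_setU1.
rewrite (eq_bigr _ E).
pose S P := \sum_(k | k \notin I) \sum_(l | (l \notin I) && P k l) F k l.
transitivity (S (fun k l => (l < k)%N) + S (fun k l => (k < l)%N)).
  rewrite -big_split; apply: eq_bigr => k kI /=.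
  rewrite (bigID (fun l => (val l < val k)%N)) /=; congr (_ + _);
  apply: eq_bigl => l; rewrite -(inj_eq val_inj)/=; case: ltngtP; rewrite ?andbT ?andbF //=.
suff -> : S (fun k l => (k < l)%N) = - S (fun k l => (l < k)%N) by rewrite subrr.
rewrite /S (exchange_big_dep (fun l => l \notin I)) /=; last by move=> k l _ /andP[].
rewrite -sumrN; apply: eq_bigr => l lI; rewrite -sumrN.
apply: eq_big => [k|k /andP[kI /andP[_ kl]]]; first by rewrite lI.
rewrite /F dsgn_anti //; last by rewrite -(inj_eq val_inj) neq_ltn kl.
by rewrite scaleNr setUCA.
Qed.

End Koszul.

(** * The FI-action on the complex and its compatibility with the differential *)

Section KoszulAct.
Variable R : comPzRingType.
Implicit Types M N : FImod R.

Lemma sign_card (T : finType) (A : {set T}) (Q : pred T) :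
  (-1) ^+ #|[set j in A | Q j]| = \prod_(j in A) (-1) ^+ Q j :> R.
Proof.
rewrite -prodr_const big_mkcond [RHS]big_mkcond; apply: eq_bigr => j _.
by rewrite inE; case: (j \in A) => //=; case: (Q j).
Qed.

Definition inv_sgn (f : nat -> nat) (i j : nat) : R := (-1) ^+ ((i < j) && (f j < f i))%N.

Lemma sgn_invE n f (I : {set 'I_n}) :
  sgn_inv R f I = \prod_(i in I) \prod_(j in I) inv_sgn f i j.
Proof.
rewrite /sgn_inv sign_card pair_big /=; apply: eq_bigl => -[i j] /=.
by rewrite inE.
Qed.

(** Checked separately for each [j] in [I]: [f] inverts the pair of [j] and [k] exactly when one,
    but not both, of [j < k] and [f j < f k] holds. So the inversions gained with [k] account for
    the change of its position. *)
Lemma sgn_inv_setU1 n n' (f : nat -> nat) (h : 'I_n -> 'I_n') (k : 'I_n) (I : {set 'I_n}) :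
  injective h -> (forall i, val (h i) = f i) -> k \notin I ->
  sgn_inv R f (k |: I) * dsgn R (h k) (h @: I) = dsgn R k I * sgn_inv R f I.
Proof.
move=> hI hE kI; rewrite !sgn_invE !big_setU1 //=.
rewrite [X in _ * X * _ ^+ _](eq_bigr (fun i : 'I_n => inv_sgn f i k *
  \prod_(j in I) inv_sgn f i j)); last by move=> i _; rewrite big_setU1.
rewrite {1}/inv_sgn ltnn /= expr0 mul1r big_split /= mulrA mulrAC.
congr (_ * _).
rewrite /dsgn.
have -> : [set j in h @: I | (j < h k)%N] = h @: [set j in I | (f j < f k)%N].
  apply/setP => j; rewrite inE; apply/andP/imsetP => [[/imsetP[i iI ->]]|[i]].
    by rewrite !hE => H; exists i => //; rewrite inE iI.
  by rewrite inE => /andP[iI H] ->; rewrite !hE imset_f.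
rewrite card_imset // !exprS !sign_card mulrCA -!big_split /=; congr (_ * _).
apply: eq_bigr => j jI; have jk : f j != f k.
  by rewrite -!hE (inj_eq val_inj) (inj_eq hI); apply: contraNneq kI => <-.
have jk' : val j != val k by rewrite (inj_eq val_inj); apply: contraNneq kI => <-.
rewrite /inv_sgn; case: (ltngtP (f j) (f k)) jk => // _ _; case: (ltngtP j k) jk' => // _ _;
by rewrite /= ?expr0 ?expr1 ?mulr1 ?mul1r ?mulrNN ?mulr1.
Qed.

Lemma SactE M a n n' f (x : Sc M a n) (J : {set 'I_n'}) : #|J| = a ->
  coef (Sact n' f x) J = \sum_(I : {set 'I_n} | (#|I| == a) && (fimg n' f I == J))
     sgn_inv R f I *: tr a I J f (coef x I).
Proof.
move=> Ja; move/eqP: (Ja) => Jab; rewrite {1}/coef insubT ffunE /=.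
pose F I := sgn_inv R f I *: tr a I J f (coef x I).
transitivity (\sum_(K : ksub n a | fimg n' f (val K) == J) F (val K)).
  by apply: eq_bigr => K _; rewrite /F coef_val.
exact: (sum_ksub _ (fun I => fimg n' f I == J)).
Qed.

Lemma fimg_inj n n' f : fi_inj n n' f -> injective (@fimg n n' f).
Proof.
move=> /fi_ord[h hI hE] I J; rewrite !(fimgE _ hE); exact: imset_inj.
Qed.

Lemma coef_Sact M a n n' f (x : Sc M a n) (I : {set 'I_n}) :
  fi_inj n n' f -> #|I| = a ->
  coef (Sact n' f x) (fimg n' f I) =
    sgn_inv R f I *: tr a I (fimg n' f I) f (coef x I).
Proof.
move=> fI Ia; rewrite SactE ?card_fimg // (big_pred1 I) // => J /=.
rewrite (inj_eq (fimg_inj fI)); case: (J =P I) => [->|]; last by rewrite andbF.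
by rewrite Ia eqxx.
Qed.

Lemma coef_Sact_out M a n n' f (x : Sc M a n) (J : {set 'I_n'}) :
  (forall I : {set 'I_n}, fimg n' f I != J) -> coef (Sact n' f x) J = 0.
Proof.
move=> H; have [Ja|Ja] := eqVneq #|J| a; last by rewrite coef_out.
by rewrite SactE // big_pred0 // => I; rewrite (negPf (H I)) andbF.
Qed.

(** An index set is the image of exactly one [I] or of none, so the sum in [Sact] has at most one
    term. *)
Lemma Sact_ext M a n n' f (x : Sc M a n) (y : Sc M a n') : fi_inj n n' f ->
  (forall I : {set 'I_n}, #|I| = a -> coef y (fimg n' f I) =
     sgn_inv R f I *: tr a I (fimg n' f I) f (coef x I)) ->
  (forall J : {set 'I_n'}, #|J| = a ->
     (forall I : {set 'I_n}, fimg n' f I != J) -> coef y J = 0) ->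
  Sact n' f x = y.
Proof.
move=> fI yI y0; apply: coef_ext => J Ja.
case: (pickP (fun I : {set 'I_n} => fimg n' f I == J)) => [I /eqP EJ|noI].
  by rewrite -EJ coef_Sact ?yI // -(card_fimg I fI) EJ.
have noI' (I : {set 'I_n}) : fimg n' f I != J by rewrite noI.
by rewrite coef_Sact_out // y0.
Qed.

Lemma tr_fimg_lin M a n n' f (I : {set 'I_n}) : fi_inj n n' f -> #|I| = a ->
  linear (@tr R M n n' a a I (fimg n' f I) f).
Proof.
by move=> fI Ia; apply: tr_lin; rewrite ?card_fimg //; apply: maps_compl_fimg.
Qed.

Lemma Sact_Smap M N (g : FIhom M N) a n n' f (x : Sc M a n) : fi_inj n n' f ->
  Sact n' f (Smap g x) = Smap g (Sact n' f x).
Proof.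
move=> fI; apply: Sact_ext => // [I Ia|J Ja H].
  rewrite !coef_Smap coef_Sact // (linZ (@hmap_lin _ _ _ _ _)).
  by rewrite (tr_hmap _ _ Ia _ (maps_compl_fimg _ fI)) ?card_fimg.
by rewrite coef_Smap coef_Sact_out // (lin0 (@hmap_lin _ _ _ _ _)).
Qed.

Lemma Sd_Sact M a n n' f (x : Sc M a.+1 n) : fi_inj n n' f ->
  Sact n' f (Sd x) = Sd (Sact n' f x).
Proof.
move=> fI; have [h hI hE] := fi_ord fI; have fE := fun I => fimgE I hE.
have hU k (I : {set 'I_n}) : fimg n' f (k |: I) = h k |: fimg n' f I.
  by rewrite !fE imsetU1.
have hin k (I : {set 'I_n}) : (h k \in fimg n' f I) = (k \in I).
  exact: mem_fimg fI (hE k).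
apply: Sact_ext => // [I Ia|J Ja H]; last first.
  (* If [J] is not an image, neither is [l |: J]: deleting from a preimage the element sent to [l]
     would leave a preimage of [J]. *)
  rewrite coef_Sd // big1 // => l lJ.
  rewrite coef_Sact_out ?(lin0 (tr_setU1_lin _ Ja)) ?scaler0 //.
  move=> I; apply/eqP => E; have: l \in fimg n' f I by rewrite E setU11.
  rewrite fE => /imsetP[k kI Ek]; have /eqP[] := H (I :\ k).
  move: E; rewrite -{1}(setD1K kI) hU -Ek => E.
  have lF : l \notin fimg n' f (I :\ k) by rewrite Ek hin setD11.
  by rewrite -(setU1K lF) E setU1K.
have Ja : #|fimg n' f I| = a by rewrite card_fimg.
rewrite !coef_Sd // (lin_sum (tr_fimg_lin fI Ia)) scaler_sumr.
rewrite (big_inj (PA := fun k => k \notin I) (h := h)); first last.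
(* An [l] outside the image of [h] contributes nothing, since no set containing it is an image. *)
- move=> l lJ H; rewrite coef_Sact_out ?(lin0 (tr_setU1_lin _ Ja)) ?scaler0 //.
  move=> K; apply/eqP => E; have: l \in fimg n' f K by rewrite E setU11.
  rewrite fE => /imsetP[k kK Ek].
  have kI : k \notin I by rewrite -hin -Ek.
  by have /eqP[] := H k kI.
- by move=> k; rewrite hin.
- by move=> k l _ _; apply: hI.
apply: eq_bigr => k kI; rewrite -hU coef_Sact //; last exact: card_setU1.
have Kk := card_setU1 kI Ia; have fKk : #|fimg n' f (k |: I)| = a.+1 by rewrite card_fimg.
have sub : maps_compl id (fimg n' f (k |: I)) (fimg n' f I).
  by rewrite hU; apply: maps_compl_setU1.
rewrite (linZ (tr_lin fKk Ja sub)) (linZ (tr_fimg_lin fI Ia)) !scalerA.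
rewrite (fE I) [in LHS]mulrC (sgn_inv_setU1 hI hE kI) mulrC -(fE I); congr (_ *: _).
rewrite (tr_comp (h := f) _ Kk fKk Ja (maps_compl_fimg _ fI) sub) //.
by rewrite (tr_comp (h := f) _ Kk Ia Ja (maps_compl_setU1 k I) (maps_compl_fimg _ fI)).
Qed.

End KoszulAct.

(** * A cover with partial injections *)

Section DependentProduct.
Variables (R : pzRingType) (I : Type) (M : I -> lmodType R).

Definition pi_lmod := forall i, M i.
HB.instance Definition _ := gen_eqMixin pi_lmod.
HB.instance Definition _ := gen_choiceMixin pi_lmod.

Let addA : associative (fun (u v : pi_lmod) i => u i + v i : M i).
Proof. by move=> u v w; apply: functional_extensionality_dep => i; rewrite addrA. Qed.
Let addC : commutative (fun (u v : pi_lmod) i => u i + v i : M i).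
Proof. by move=> u v; apply: functional_extensionality_dep => i; rewrite addrC. Qed.
Let add0 : left_id (fun i => 0 : M i) (fun (u v : pi_lmod) i => u i + v i : M i).
Proof. by move=> u; apply: functional_extensionality_dep => i; rewrite add0r. Qed.
Let addN : left_inverse (fun i => 0 : M i) (fun (u : pi_lmod) i => - u i : M i)
  (fun (u v : pi_lmod) i => u i + v i : M i).
Proof. by move=> u; apply: functional_extensionality_dep => i; rewrite addNr. Qed.
HB.instance Definition _ := GRing.isZmodule.Build pi_lmod addA addC add0 addN.

Let scaleA (a b : R) (u : pi_lmod) : (fun i => a *: (b *: u i)) = (fun i => (a * b) *: u i).
Proof. by apply: functional_extensionality_dep => i; rewrite scalerA. Qed.
Let scale1 : left_id 1 (fun (a : R) (u : pi_lmod) i => a *: u i : M i).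
Proof. by move=> u; apply: functional_extensionality_dep => i; rewrite scale1r. Qed.
Let scaleDr : right_distributive (fun (a : R) (u : pi_lmod) i => a *: u i : M i) +%R.
Proof. by move=> a u v; apply: functional_extensionality_dep => i; apply: scalerDr. Qed.
Let scaleDl (u : pi_lmod) (a b : R) :
  (fun i => (a + b) *: u i) = ((fun i => a *: u i) : pi_lmod) + (fun i => b *: u i).
Proof. by apply: functional_extensionality_dep => i; apply: scalerDl. Qed.
HB.instance Definition _ :=
  GRing.Zmodule_isLmodule.Build R pi_lmod scaleA scale1 scaleDr scaleDl.
End DependentProduct.

Section Cover.
Variables (R : comPzRingType) (M : FImod R).

(* The copy of V_m indexed by s only matters for [cover_eval] when s is
   duplicate-free of size m; the others are kept to avoid a subtype. *)
Definition cover_car n : lmodType R := pi_lmod (fun p : nat * seq 'I_n => Mc M p.1).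

(** [g] is the partial inverse of the partial injection from [n] to [n'] that acts: a sequence in
    [n'] is read back in [n], and counts 0 if some entry has no preimage. *)
Definition pull n n' (g : 'I_n' -> option 'I_n) (u : cover_car n) : cover_car n' :=
  fun p => if all (isSome \o g) p.2 then u (p.1, pmap g p.2) else 0.

Lemma cover_linE n c (u v : cover_car n) p : (c *: u + v) p = c *: u p + v p.
Proof. by []. Qed.

Lemma pull_lin n n' (g : 'I_n' -> option 'I_n) : linear (pull g).
Proof.
move=> c u v; apply: functional_extensionality_dep => p; rewrite cover_linE /pull.
by case: ifP => _; rewrite ?scaler0 ?addr0 // cover_linE.
Qed.

Lemma pull_ext n n' (g h : 'I_n' -> option 'I_n) u : g =1 h -> pull g u = pull h u.
Proof.
move=> gh; apply: functional_extensionality_dep => p; rewrite /pull.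
by rewrite (eq_pmap gh) (eq_all (a2 := isSome \o h)) // => j /=; rewrite gh.
Qed.

Lemma pull_id n (u : cover_car n) : pull Some u = u.
Proof.
apply: functional_extensionality_dep => -[m s]; rewrite /pull /=.
have -> : all (isSome \o Some) s by elim: s.
by have -> : pmap Some s = s by elim: s => //= i s ->.
Qed.

Lemma pull_comp n n' n'' (g : 'I_n' -> option 'I_n) (h : 'I_n'' -> option 'I_n') u :
  pull h (pull g u) = pull (fun k => obind g (h k)) u.
Proof.
apply: functional_extensionality_dep => -[m s]; rewrite /pull /=.
have -> : pmap (fun k => obind g (h k)) s = pmap g (pmap h s).
  by elim: s => //= k s IH; case: (h k) => //= j; case: (g j) => //= i; rewrite IH.
have -> : all (isSome \o (fun k => obind g (h k))) s =
    all (isSome \o h) s && all (isSome \o g) (pmap h s).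
  elim: s => //= k s ->; case: (h k) => //= j.
  by rewrite andbCA; case: (g j).
by case: all.
Qed.

(** Two maps into a common target serve two purposes: with [g = id] this is the partial inverse of
    [f]; with [cemb I] and [cemb J] it matches the positions of one element in two complements. *)
Definition pre n n' (f g : nat -> nat) (j : 'I_n') : option 'I_n :=
  [pick i : 'I_n | f i == g j].

Lemma preP n n' (f g : nat -> nat) (j : 'I_n') (i : 'I_n) :
  {in gtn n &, injective f} -> (pre n f g j = Some i) <-> f i = g j.
Proof.
move=> fI; rewrite /pre; case: pickP => [k /eqP E|H]; split=> //.
- by case=> <-.
- move=> E'; congr Some; apply: val_inj; apply: fI; rewrite ?inE //=.
  by rewrite E E'.
- by move=> E; have := H i; rewrite E eqxx.
Qed.

Lemma option_ext (T : Type) (u v : option T) :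
  (forall i, u = Some i <-> v = Some i) -> u = v.
Proof.
case: u v => [i|] [j|] // H; first by case: (H i) => -> //.
  by case: (H i) => /(_ erefl).
by case: (H j) => _ /(_ erefl).
Qed.

Lemma fi_injP m n f : fi_inj m n f -> {in gtn m &, injective f}.
Proof. by move=> [_ fI] i j; rewrite !inE; apply: fI. Qed.

Definition cover_pre : FIpre R :=
  {| car := cover_car; act := fun m n f => pull (pre m f id) |}.

Definition fi_cover : FImod R.
Proof.
exists cover_pre.
- by move=> m n f fI r x y; apply: pull_lin.
- move=> m n f g fg x; apply: pull_ext => j; rewrite /pre.
  by apply: eq_pick => i; rewrite /= fg.
- move=> m x; rewrite -[RHS]pull_id; apply: pull_ext => j.
  apply: option_ext => i; rewrite preP //; split=> [/val_inj->//|[->//]].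
- move=> l m n f g fI gI x /=; rewrite pull_comp; apply: pull_ext => j.
  have gfI : {in gtn l &, injective (g \o f)}.
    move=> i i' il i'l /= E; apply: (fi_injP fI) => //.
    by apply: (fi_injP gI) E; rewrite !inE; apply: fI.1.
  apply: option_ext => i; rewrite preP //=; split.
    move=> E; have -> : pre m g id j = Some (Ordinal (fI.1 _ (ltn_ord i))).
      by apply/(preP _ _ _ (fi_injP gI)).
    by apply/(preP _ _ _ (fi_injP fI)).
  case E: (pre m g id j) => [k|] //=; move/(preP _ _ _ (fi_injP fI)) => ->.
  by move/(preP _ _ _ (fi_injP gI)): E => E'; rewrite E'.
Defined.

(** A duplicate-free sequence of length [m] is an injection of [m] into [n], and it acts on its
    coordinate. Only lengths up to [n] occur, so the sum is finite although the product is not. *)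
Definition cover_eval n (u : cover_car n) : Mc M n :=
  \sum_(m < n.+1) \sum_(s : m.-tuple 'I_n | uniq s)
    Ma n (nth 0%N (map val s)) (u (val m, val s)).

Lemma uniq_fi m n (s : m.-tuple 'I_n) : uniq s -> fi_inj m n (nth 0%N (map val s)).
Proof.
move=> us; have sz : size (map val s) = m by rewrite size_map size_tuple.
split=> [i im|i j im jm E].
  have /mapP[k _ ->] : nth 0%N (map val s) i \in map val s by rewrite mem_nth ?sz.
  exact: ltn_ord.
apply/eqP; rewrite -(nth_uniq 0%N (s := map val s)) ?sz ?E //.
by rewrite map_inj_uniq //; apply: val_inj.
Qed.

Lemma cover_eval_widen n N (u : cover_car n) : (n < N)%N ->
  cover_eval u = \sum_(m < N) \sum_(s : m.-tuple 'I_n | uniq s)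
    Ma n (nth 0%N (map val s)) (u (val m, val s)).
Proof.
move=> nN; rewrite /cover_eval.
pose F m := \sum_(s : m.-tuple 'I_n | uniq s) Ma n (nth 0%N (map val s)) (u (m, val s)).
rewrite (big_ord_widen N F nN) [LHS]big_mkcond; apply: eq_bigr => m _.
case: ltnP => // nm; rewrite big_pred0 // => s; apply/negP => us.
by have := max_card (mem (val s)); rewrite (card_uniqP us) size_tuple card_ord leqNgt nm.
Qed.

Lemma pull_map m n (f : nat -> nat) (h : 'I_m -> 'I_n) (u : cover_car m) k (s : seq 'I_m) :
  injective h -> (forall i, val (h i) = f i) ->
  pull (pre m f id) u (k, map h s) = u (k, s).
Proof.
move=> hI hE; have preh i : pre m f id (h i) = Some i.
  rewrite /pre; case: pickP => [k' /= /eqP|/(_ i)/=]; last by rewrite -hE eqxx.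
  by rewrite -hE => /val_inj/hI->.
rewrite /pull /=.
have -> : all (isSome \o pre m f id) (map h s) by elim: s => //= i s ->; rewrite preh.
by have -> : pmap (pre m f id) (map h s) = s by elim: s => //= i s ->; rewrite preh.
Qed.

Lemma pull_out m n (f : nat -> nat) (h : 'I_m -> 'I_n) (u : cover_car m) k (t : seq 'I_n) :
  (forall i, val (h i) = f i) -> (forall s, map h s <> t) ->
  pull (pre m f id) u (k, t) = 0.
Proof.
move=> hE nt; rewrite /pull /=; case: allP => // ht; exfalso.
elim: t nt ht => [|j t IH] nt ht; first exact: (nt [::]).
apply: IH => [s E|k' kt]; last by apply: ht; rewrite inE kt orbT.
have := ht j (mem_head _ _); rewrite /= /pre; case: pickP => // i /eqP Ei _.
by apply: (nt (i :: s)); rewrite /= E; congr cons; apply: val_inj; rewrite hE.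
Qed.

(** The duplicate-free sequences in [n] with all entries in the image of [f] come from unique ones
    in [m]; on the others the pulled-back family vanishes. *)
Lemma cover_eval_nat m n f : fi_inj m n f ->
  forall u, cover_eval (pull (pre m f id) u) = Ma n f (@cover_eval m u).
Proof.
move=> fI u; have [h hI hE] := fi_ord fI.
(* A common bound for the lengths: the extra terms on either side are empty sums, as no
   duplicate-free sequence is that long. *)
have nN : (n < (m + n).+1)%N by rewrite ltnS leq_addl.
have mN : (m < (m + n).+1)%N by rewrite ltnS leq_addr.
rewrite (cover_eval_widen _ nN) (cover_eval_widen _ mN) (lin_sum (Ma_lin fI)).
apply: eq_bigr => k _; rewrite (lin_sum (Ma_lin fI)).
rewrite (big_inj (PA := fun s : k.-tuple 'I_m => uniq s) (h := map_tuple h)).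
- apply: eq_bigr => s us; rewrite (pull_map _ _ _ hI hE) /Ma -act_comp //;
    last exact: uniq_fi.
  apply: act_ext => i ik; rewrite /= -map_comp.
  rewrite !(nth_map (tnth s (Ordinal ik))) ?size_tuple //= hE //.
- by move=> s t _ _ /(congr1 val)/(inj_map hI)/val_inj.
- by move=> s us; rewrite map_inj_uniq.
- move=> t ut H; rewrite (pull_out _ _ hE) ?(lin0 (Ma_lin (uniq_fi ut))) // => s E.
  have ss : size s == k by rewrite -(size_map h) E size_tuple.
  have us : uniq s by rewrite -(map_inj_uniq hI) E.
  by have /eqP[] := H (Tuple ss) us; apply: val_inj.
Qed.

Definition cover_hom : FIhom fi_cover M.
Proof.
exists (@cover_eval); last exact: cover_eval_nat.
move=> n r x y; rewrite /cover_eval scaler_sumr -big_split; apply: eq_bigr => m _.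
rewrite scaler_sumr -big_split; apply: eq_bigr => s us /=.
by rewrite -(Ma_lin (uniq_fi us)).
Defined.

Lemma cover_surj n (y : Mc M n) : exists x, hmap cover_hom x = y.
Proof.
(* The family concentrated at the identity sequence. There [p.1] equals [n], and [Ma p.1 id] only
   adjusts the type. *)
exists ((fun p => if (p.1 == n) && (p.2 == enum 'I_n)
  then Ma p.1 id y else 0) : cover_car n).
rewrite /= /cover_eval (bigD1 ord_max) //= [X in _ + X]big1 ?addr0; last first.
  move=> m mn; rewrite big1 // => s us; rewrite -(inj_eq val_inj) /= in mn.
  by rewrite (negPf mn) /= (lin0 (Ma_lin (uniq_fi us))).
have sz : size (enum 'I_n) == n by rewrite size_enum_ord.
rewrite (bigD1 (Tuple sz)) ?enum_uniq //= [X in _ + X]big1 ?addr0; last first.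
  move=> s /andP[us sE]; rewrite -(inj_eq val_inj) /= in sE.
  by rewrite (negPf sE) andbF (lin0 (Ma_lin (uniq_fi us))).
rewrite !eqxx /= {2}/Ma act_id -[RHS]act_id; apply: act_ext => i im.
by rewrite val_enum_ord nth_iota.
Qed.

End Cover.

(** * Acyclicity of the complex of a projective *)

Section Acyclic.
Variables (R : comPzRingType) (M : FImod R).
Local Notation Q := (fi_cover M).

(* Identity on [n] \ (I u J), zero on sequences leaving it; defined for any
   I and J, while [tr] needs J to be contained in I. *)
Definition res n a b (I J : {set 'I_n}) : Mc Q (n - a) -> Mc Q (n - b) :=
  @pull R M _ _ (pre (n - a) (cemb I) (cemb J)).

Arguments res {n a} b I J _.

Lemma cemb_inj n a (I : {set 'I_n}) : #|I| = a -> {in gtn (n - a)%N &, injective (cemb I)}.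
Proof.
move=> <- k l; rewrite !inE => kI lI E.
by rewrite -(cembK kI) -(cembK lI) E.
Qed.

(** Both sides match each element outside [I] with itself. This puts the inclusions in the
    differential and the restrictions in the homotopy into one calculus. *)
Lemma tr_res n a b (I J : {set 'I_n}) (x : Mc Q (n - a)) :
  #|I| = a -> #|J| = b -> J \subset I ->
  @tr R Q n n a b I J id x = res b I J x.
Proof.
move=> Ia Jb JI; apply: pull_ext => j; apply: option_ext => i.
have fi := tr_fi Ia Jb (maps_compl_sub JI).
rewrite (preP _ _ _ (fi_injP fi)) (preP _ _ _ (cemb_inj Ia)) /tmap.
have : (i < n - #|I|)%N by rewrite Ia.
have : (j < n - #|J|)%N by rewrite Jb.
move=> jJ /cembP[k kI Ek]; rewrite -Ek.
have kJ : k \notin J by apply: contra kI; apply: (subsetP JI).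
by split=> [/= <-|/= ->]; rewrite ?cidxK // cembK.
Qed.

Lemma res_id n a (I : {set 'I_n}) (x : Mc Q (n - a)) : #|I| = a -> res a I I x = x.
Proof.
move=> Ia; rewrite -[RHS]pull_id; apply: pull_ext => j; apply: option_ext => i.
rewrite (preP _ _ _ (cemb_inj Ia)); split=> [E|[->//]].
by congr Some; apply: val_inj; apply: (cemb_inj Ia) => //; rewrite inE /=.
Qed.

(** Elements outside both [I] and [K] must survive the passage through the complement of [J]; this
    is the inclusion assumed. *)
Lemma res_comp n a b c (I J K : {set 'I_n}) (x : Mc Q (n - a)) :
  #|I| = a -> #|J| = b -> #|K| = c -> J \subset I :|: K ->
  res c J K (res b I J x) = res c I K x.
Proof.
move=> Ia Jb Kc JIK; rewrite /res pull_comp; apply: pull_ext => k.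
apply: option_ext => i; rewrite (preP _ _ _ (cemb_inj Ia)); split.
  case E: (pre _ _ _ k) => [j|] //=; move/(preP _ _ _ (cemb_inj Ia)) => ->.
  by move/(preP _ _ _ (cemb_inj Jb)): E.
move=> E; have : (i < n - #|I|)%N by rewrite Ia.
have : (k < n - #|K|)%N by rewrite Kc.
move=> /cembP[w wK Ew] /cembP[w' wI Ew'].
have {}Ew' : w = w' by apply: val_inj; rewrite Ew Ew' E.
have wJ : w \notin J.
  by apply/negP => /(subsetP JIK); rewrite inE {1}Ew' (negPf wI) (negPf wK).
have wb : (cidx J w < n - b)%N by rewrite -Jb cidx_lt.
have -> : pre (n - b) (cemb J) (cemb K) k = Some (Ordinal wb).
  by apply/(preP _ _ _ (cemb_inj Jb)); rewrite /= cidxK.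
by apply/(preP _ _ _ (cemb_inj Ia)); rewrite /= cidxK // E.
Qed.

Lemma res_lin n a b (I J : {set 'I_n}) : linear (@res n a b I J).
Proof. exact: (@pull_lin R M). Qed.

(** The sign is the one with which the differential removes [i] again, so it amounts to wedging with
    [-i] on the left. *)
Definition htpy n a (i : 'I_n) (x : Sc Q a n) : Sc Q a.+1 n :=
  mkS (fun K : {set 'I_n} => if i \in K then
         dsgn R i (K :\ i) *: res a.+1 (K :\ i) K (coef x (K :\ i)) else 0).

Lemma coef_htpy n a i (x : Sc Q a n) (B : {set 'I_n}) : i \notin B -> #|B| = a ->
  coef (htpy i x) (i |: B) = dsgn R i B *: res a.+1 B (i |: B) (coef x B).
Proof.
by move=> iB Ba; rewrite coef_mkS ?(card_setU1 iB Ba) //= setU11 setU1K.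
Qed.

(** In the second summand, removing [i] and putting it back returns [x], because inclusion followed
    by restriction is the identity. Every other [k] occurs in both summands with opposite signs. *)
Lemma htpyP n a i (x : Sc Q a.+1 n) (I : {set 'I_n}) : i \in I ->
  coef (Sd (htpy i x)) I + coef (htpy i (Sd x)) I = coef x I.
Proof.
have [Ia|Ia] := eqVneq #|I| a.+1; last by rewrite !coef_out // addr0.
move=> iI; have iB : i \notin I :\ i by rewrite setD11.
have := cardsD1 i I; rewrite iI Ia => -[/esym Ba].
rewrite -[I](setD1K iI); move: (I :\ i) iB Ba => B iB Ba {I iI Ia}.
have iBa := card_setU1 iB Ba.
rewrite coef_Sd // coef_htpy // coef_Sd // (lin_sum (@res_lin _ _ _ _ _)) scaler_sumr.
rewrite [X in _ + X](bigD1 i) //= tr_res ?subsetU1 // (linZ (@res_lin _ _ _ _ _)).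
rewrite scalerA dsgn_sqr scale1r res_comp ?res_id ?subsetUl //; last first.
  by rewrite setUC -setUA subsetUl.
rewrite addrCA -[RHS]addr0; congr (_ + _); apply/eqP; rewrite addr_eq0 -sumrN; apply/eqP.
apply: eq_big => [k|k]; first by rewrite !inE negb_or andbC.
rewrite !inE negb_or => /andP[ki kB].
have kBa := card_setU1 kB Ba.
have kiB : k \notin i |: B by rewrite !inE negb_or ki.
have ikB : i \notin k |: B by rewrite !inE negb_or eq_sym ki.
rewrite setUCA coef_htpy // setUCA tr_res ?subsetU1 //; last first.
  by rewrite (card_setU1 kiB iBa).
rewrite !(linZ (@res_lin _ _ _ _ _)) tr_res ?subsetU1 // !res_comp //.
- rewrite !scalerA -scaleNr; congr (_ *: _).
  rewrite !dsgnU1 // -mulrN mulrACA [RHS]mulrN mulrC [dsgn R k B * _]mulrC.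
  move: ki; rewrite -(inj_eq val_inj) neq_ltn => /orP[] H; rewrite H ltnNge ltnW //=;
  by rewrite expr0 expr1 ?mulr1 ?mul1r mulrN1.
- by apply/subsetP => l; rewrite !inE => ->; rewrite !orbT.
- by rewrite (card_setU1 kiB iBa).
- by apply/subsetP => l; rewrite !inE; case: (l == k); case: (l == i); case: (l \in B).
Qed.

Definition vanish n a (j : 'I_n) (x : Sc Q a n) :=
  forall I : {set 'I_n}, j \in I -> coef x I = 0.

Lemma vanish_htpy n a i j (x : Sc Q a n) : i != j -> vanish j x -> vanish j (htpy i x).
Proof.
move=> ij xj I jI; have [Ia|Ia] := eqVneq #|I| a.+1; last by rewrite coef_out.
rewrite coef_mkS //=; case: ifP => // iI.
by rewrite xj ?inE ?jI 1?eq_sym ?ij // (lin0 (@res_lin _ _ _ _ _)) scaler0.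
Qed.

Lemma vanish_Sd n a j (x : Sc Q a.+1 n) : vanish j x -> vanish j (Sd x).
Proof.
move=> xj I jI; have [Ia|Ia] := eqVneq #|I| a; last by rewrite coef_out.
rewrite coef_Sd // big1 // => k kI; rewrite xj ?inE ?jI ?orbT //.
by rewrite (lin0 (tr_setU1_lin kI Ia)) scaler0.
Qed.

Lemma cover_acyclic n a (x : Sc Q a.+1 n) : Sd x = 0 -> exists y, Sd y = x.
Proof.
move=> dx; have ih (s : seq 'I_n) : exists y, forall j, j \in s -> vanish j (x - Sd y).
  elim: s => [|i s [y yP]]; first by exists 0.
  set x' := x - Sd y in yP.
  have dx' : Sd x' = 0 by rewrite (linB (@Sd_lin _ _ _ _)) dx SdSd subr0.
  have key (I : {set 'I_n}) : i \in I -> coef (x' - Sd (htpy i x')) I = 0.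
    move=> iI; rewrite (linB (@coef_lin _ _ _ _ _)) -[X in X - _](htpyP x' iI) dx'.
    rewrite addrAC subrr add0r; have [Ia|Ia] := eqVneq #|I| a.+1; last by rewrite coef_out.
    by rewrite coef_mkS //= iI (lin0 (@coef_lin _ _ _ _ _))
      (lin0 (@res_lin _ _ _ _ _)) scaler0.
  exists (y + htpy i x') => j; rewrite (linD (@Sd_lin _ _ _ _)) opprD addrA -/x'.
  have [<- _|ij] := eqVneq i j; first exact: key.
  rewrite inE eq_sym (negPf ij) /= => js I jI.
  rewrite (linB (@coef_lin _ _ _ _ _)) (yP j js I jI).
  by rewrite (vanish_Sd (vanish_htpy ij (yP j js))) // subr0.
have [y yP] := ih (enum 'I_n); exists y; apply/esym/eqP; rewrite -subr_eq0; apply/eqP.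
apply: coef_ext => I Ia; rewrite (lin0 (@coef_lin _ _ _ _ _)).
(* Only the component at the empty set could remain, and it is absent in degree [a.+1]. *)
have [I0|[i iI]] := set_0Vmem I; first by move: Ia; rewrite I0 cards0.
by apply: (yP i _ I iI); rewrite mem_enum.
Qed.

End Acyclic.

(** * From the cover to a projective FI-module *)

Section Projective.
Variables (R : comPzRingType) (P : FImod R).

Definition FIhom_id : FIhom P P.
Proof. by exists (fun _ x => x). Defined.

(** Projectivity lifts the identity to a section [k] of the cover. The cycle is moved along [k],
    bounded there, and the bounding chain is projected back. *)
Lemma projective_acyclic n a (x : Sc P a.+1 n) :
  FIprojective P -> Sd x = 0 -> exists y, Sd y = x.
Proof.
move=> /(_ _ _ (cover_hom P) FIhom_id (@cover_surj _ P))[k kP] dx.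
have dkx : Sd (Smap k x) = 0 by rewrite Sd_Smap dx (lin0 (@Smap_lin _ _ _ _ _ _)).
have [y yP] := cover_acyclic dkx; exists (Smap (cover_hom P) y).
by rewrite Sd_Smap yP; apply/ffunP => K; rewrite !ffunE kP.
Qed.

End Projective.

(** * The double complex of a resolution *)

Section DegreeZero.
Variable R : comPzRingType.
Implicit Types M N : FImod R.

Lemma cemb0 n k : (k < n)%N -> cemb (set0 : {set 'I_n}) k = k.
Proof.
move=> kn; rewrite /cemb setC0 (eq_enum (in_setT (T := 'I_n))).
by rewrite -[enum _]/(enum 'I_n) val_enum_ord nth_iota.
Qed.

Lemma cidx0 n k : (k < n)%N -> cidx (set0 : {set 'I_n}) k = k.
Proof.
move=> kn; rewrite -{1}(cemb0 kn) cembK // cards0 subn0 //.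
Qed.

Lemma fi_subn0 n : fi_inj n (n - 0) id.
Proof. by split=> // i; rewrite subn0. Qed.

Lemma fi_subn0V n : fi_inj (n - 0) n id.
Proof. by split=> // i; rewrite subn0. Qed.

(** The identification of [M] with the degree 0 term. [n - 0] is not [n] by computation, so the
    identity acts as a transport. *)
Definition emb0 M n (x : Mc M n) : Sc M 0 n := mkS (fun _ => Ma (n - 0) id x).
Definition proj0 M n (z : Sc M 0 n) : Mc M n := Ma n id (coef z set0).

Lemma emb0K M n : cancel (@emb0 M n) (@proj0 M n).
Proof.
move=> x; rewrite /proj0 coef_mkS ?cards0 // /Ma -act_comp; last 2 first.
- exact: fi_subn0.
- exact: fi_subn0V.
exact: act_id.
Qed.

Lemma proj0K M n : cancel (@proj0 M n) (@emb0 M n).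
Proof.
move=> z; apply: coef_ext => I /cards0_eq ->; rewrite coef_mkS ?cards0 //.
rewrite /proj0 /Ma -act_comp; first exact: act_id.
- exact: fi_subn0V.
- exact: fi_subn0.
Qed.

Lemma emb0_lin M n : linear (@emb0 M n).
Proof.
move=> c x y; apply: coef_ext => I I0; rewrite coef_lin !coef_mkS //.
exact: (Ma_lin (fi_subn0 n)).
Qed.

Lemma Smap_emb0 M N (g : FIhom M N) n (x : Mc M n) : Smap g (emb0 x) = emb0 (hmap g x).
Proof.
apply: coef_ext => I I0; rewrite coef_Smap !coef_mkS // hnat //; exact: fi_subn0.
Qed.

Lemma Sact_emb0 M n n' f (x : Mc M n) : fi_inj n n' f ->
  Sact n' f (emb0 x) = emb0 (Ma n' f x).
Proof.
move=> fI; have f0 : fimg n' f (set0 : {set 'I_n}) = set0.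
  by apply: cards0_eq; rewrite card_fimg // cards0.
apply: Sact_ext => // [I /cards0_eq ->|J /cards0_eq -> /(_ set0)]; last first.
  by rewrite f0 eqxx.
rewrite f0 !coef_mkS ?cards0 // sgn_invE big_set0 scale1r /tr /Ma.
rewrite -!act_comp //; last 3 first.
- exact: fi_subn0.
- by apply: tr_fi; rewrite ?cards0 // -[X in maps_compl _ _ X]f0; apply: maps_compl_fimg.
- exact: fi_subn0.
apply: act_ext => i im; rewrite /tmap /= cemb0 // cidx0 //; exact: fI.1.
Qed.

Lemma inJ_hmap M N (g : FIhom M N) n (x : Mc M n) :
  inJ x -> @inJ R (fipre N) n (hmap g x).
Proof.
elim=> [|u v _ Ju _ Jv|c u _ Ju|m f y mn fI].
- by rewrite (lin0 (@hmap_lin _ _ _ _ _)); apply: inJ0.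
- by rewrite (linD (@hmap_lin _ _ _ _ _)); apply: inJadd.
- by rewrite (linZ (@hmap_lin _ _ _ _ _)); apply: inJscale.
- by rewrite (hnat g fI); apply: inJgen.
Qed.

Lemma inJ_sum (M : FIpre R) (I : finType) (A : pred I) n (F : I -> car M n) :
  (forall i, A i -> inJ (F i)) -> inJ (\sum_(i | A i) F i).
Proof. by move=> H; elim/big_ind: _ => //; [apply: inJ0 | apply: inJadd]. Qed.

Lemma fi_inj_miss m n f : (m < n)%N -> fi_inj m n f ->
  exists k : 'I_n, forall i, (i < m)%N -> f i != k.
Proof.
move=> mn /fi_ord[h hI hE]; have [k kh] : exists k, k \notin [set h i | i : 'I_m].
  apply/existsP; rewrite -negb_forall; apply/forallP => H.
  have : (n <= #|[set h i | i : 'I_m]|)%N.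
    by rewrite -[n in leqLHS]card_ord subset_leq_card //; apply/subsetP => k _.
  by rewrite leqNgt (leq_ltn_trans (leq_imset_card _ _)) // cardT size_enum_ord.
exists k => i im; apply: contra kh => /eqP E.
by apply/imsetP; exists (Ordinal im) => //; apply: val_inj; rewrite hE.
Qed.

(** An injection from a smaller set misses some [k], so it factors through the complement of [k];
    conversely each term of the differential comes from such a complement. *)
Lemma inJ_Sd M n (x : Mc M n) : @inJ R (fipre M) n x <-> exists y, Sd y = emb0 x.
Proof.
split=> [|[y dy]].
  elim=> [|u v _ [y dy] _ [z dz]|c u _ [y dy]|m f v mn fI].
  - by exists 0; rewrite (lin0 (@Sd_lin _ _ _ _)) (lin0 (@emb0_lin _ _)).
  - by exists (y + z); rewrite (linD (@Sd_lin _ _ _ _)) dy dz (linD (@emb0_lin _ _)).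
  - by exists (c *: y); rewrite (linZ (@Sd_lin _ _ _ _)) dy (linZ (@emb0_lin _ _)).
  have [k kf] := fi_inj_miss mn fI.
  have fk : fi_inj m (n - 1) (fun i => cidx [set k] (f i)).
    have nk i : (i < m)%N -> exists2 j : 'I_n, j \notin [set k] & val j = f i.
      move=> im; exists (Ordinal (fI.1 i im)) => //.
      by rewrite inE -(inj_eq val_inj) /= kf.
    split=> [i /nk[j jk <-]|i j im jm].
      by have := cidx_lt jk; rewrite cards1.
    have [i' ik Ei] := nk i im; have [j' jk Ej] := nk j jm.
    rewrite -Ei -Ej => /(congr1 (cemb [set k])); rewrite !cidxK // Ei Ej.
    exact: fI.2.
  (* [v] is carried only to the complement of the missed [k]; the sign cancels the one in [Sd]. *)
  exists (mkS (fun I => if I == [set k] then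
    dsgn R k set0 *: Ma (n - 1) (fun i => cidx [set k] (f i)) v else 0)).
  apply: coef_ext => I /cards0_eq ->; rewrite coef_Sd ?cards0 // coef_mkS ?cards0 //.
  rewrite (bigD1 k) ?inE //= big1 ?addr0 => [|l]; last first.
    rewrite !inE /= => lk; rewrite coef_mkS ?setU0 ?cards1 // (inj_eq set1_inj) (negPf lk).
    by rewrite -[set1 l]setU0 (lin0 (tr_setU1_lin _ _)) ?scaler0 ?cards0 ?inE.
  have k0 : k \notin set0 by rewrite inE.
  have klin := tr_lin (M := M) (cards1 k) (cards0 _) (maps_compl_sub (sub0set [set k])).
  rewrite setU0 coef_mkS ?cards1 // eqxx (linZ klin) scalerA dsgn_sqr scale1r /tr /Ma.
  rewrite -!act_comp //; last 2 first.
  - exact: fi_subn0.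
  - by apply: tr_fi; rewrite ?cards0 ?cards1 //; apply: maps_compl_sub; apply: sub0set.
  apply: act_ext => i im; have fin := fI.1 i im.
  have ik : Ordinal fin \notin [set k] by rewrite inE -(inj_eq val_inj) /= kf.
  by rewrite /tmap /= -[f i]/(val (Ordinal fin)) cidxK // cidx0.
rewrite -[x]emb0K -dy /proj0 coef_Sd ?cards0 // (lin_sum (Ma_lin (fi_subn0V n))).
apply: inJ_sum => k k0; rewrite (linZ (Ma_lin (fi_subn0V n))); apply: inJscale.
have fi : fi_inj (n - 1) (n - 0) (tmap (k |: set0) (set0 : {set 'I_n}) id).
  by apply: tr_fi; [rewrite setU0 cards1 | rewrite cards0 | apply: maps_compl_setU1].
rewrite /tr /Ma -act_comp //; last exact: fi_subn0V.
(* [n - 1 < n] needs [n] positive, which the existence of [k] in [n] gives. *)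
apply: inJgen; first by rewrite subn1 ltn_predL (leq_ltn_trans _ (ltn_ord k)).
by case: fi => fl fI; split=> // i im; have := fl i im; rewrite subn0.
Qed.

End DegreeZero.

(** * Rows, columns and the walk along the antidiagonal *)

Section Resolution.
Variable R : comPzRingType.

Lemma Smap_exact (L M N : FImod R) (g : FIhom M N) (h : FIhom L M) a n (x : Sc M a n) :
  (forall n (x : Mc M n), hmap g x = 0 <-> exists y, hmap h y = x) ->
  Smap g x = 0 <-> exists y, Smap h y = x.
Proof.
move=> gh; split=> [gx|[y <-]]; last first.
  by apply/ffunP => K; rewrite !ffunE; apply/gh; exists (y K).
have ex (K : ksub n a) : exists y, hmap h y = x K.
  by apply/gh; move/ffunP/(_ K): gx; rewrite !ffunE.
exists [ffun K => projT1 (cid (ex K))]; apply/ffunP => K; rewrite !ffunE.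
exact: projT2 (cid (ex K)).
Qed.

Lemma Smap_surj (M N : FImod R) (g : FIhom M N) a n (y : Sc N a n) :
  (forall n (y : Mc N n), exists x, hmap g x = y) -> exists x, Smap g x = y.
Proof.
move=> gs; exists [ffun K => projT1 (cid (gs _ (y K)))].
by apply/ffunP => K; rewrite !ffunE; apply: projT2 (cid (gs _ (y K))).
Qed.

Variables (V : FImod R) (P : nat -> FImod R) (dP : forall a, FIhom (P a.+1) (P a))
  (eps : FIhom (P 0%N) V).
Hypothesis resP : is_proj_resolution dP eps.

Let epsP a n (x : Sc (P 0) a n) : Smap eps x = 0 <-> exists y, Smap (dP 0%N) y = x.
Proof. by apply: Smap_exact => m z; apply: resP.2.2.1. Qed.
Let dPP q a n (x : Sc (P q.+1) a n) : Smap (dP q) x = 0 <-> exists y, Smap (dP q.+1) y = x.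
Proof. by apply: Smap_exact => m z; apply: resP.2.2.2. Qed.
Let dPdP q a n (x : Sc (P q.+2) a n) : Smap (dP q) (Smap (dP q.+1) x) = 0.
Proof. by apply/dPP; exists x. Qed.
Let acyclic q a n (x : Sc (P q) a.+1 n) : Sd x = 0 -> exists y, Sd y = x.
Proof. exact: projective_acyclic (resP.1 q). Qed.

(** One step of continuing [z] to a total cycle, towards smaller [q]; acyclicity of the columns
    supplies the later steps. At the edge [q = 0] there is nothing to continue. *)
Definition row_liftable q p n : Sc (P q) p n -> Prop :=
  match q as q0 return Sc (P q0) p n -> Prop with
  | 0%N => fun _ => True
  | q'.+1 => fun z => exists u, Sd u = Smap (dP q') z
  end.

(** The same towards smaller [p], with later steps supplied by exactness of the rows. *)
Definition col_liftable q p n : Sc (P q) p n -> Prop :=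
  match p as p0 return Sc (P q) p0 n -> Prop with
  | 0%N => fun _ => True
  | p'.+1 => fun z => exists u, Smap (dP q) u = Sd z
  end.

(* The homology of the total complex of [Stilde p (P q)], read off at [(q, p)]. *)
Definition corner q p : SQ R :=
  {| sq_mod := Stilde (P q) p;
     sq_K := fun n z => row_liftable z /\ col_liftable z;
     sq_L := fun n z => exists u w, z = Sd u + Smap (dP q) w |}.

(** One liftability condition on each side is the relation itself; the other follows from exactness
    of the row at [P q.+1], respectively of a column in degree [p.+1]. *)
Lemma corner_step q p : SQ_rel (corner q.+1 p) (corner q p.+1).
Proof.
exists (fun n (z : Sc (P q.+1) p n) (z' : Sc (P q) p.+1 n) => Smap (dP q) z = Sd z').
split; first split.
- move=> n z z' E; split; split.
  + by exists z'.
  + case: p z z' E => //= p z z' E; apply/dPP.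
    by rewrite -Sd_Smap E SdSd.
  + case: q z z' E => //= q z z' E; apply: acyclic.
    by rewrite Sd_Smap -E dPdP.
  + by exists z.
- by move=> n c x y x' y' E E'; rewrite (Smap_lin (dP q)) Sd_lin E E'.
- by move=> m n f x y fI E; rewrite /= -Sact_Smap // E Sd_Sact.
- by move=> n z [[z' E] _]; exists z'.
- by move=> n z' [_ [z E]]; exists z.
move=> n z z' E; split=> [[u [w Ez]]|[u [w Ez]]].
  (* [z] and [Sd u] have the same image under [dP q], so this difference is a cycle; the [u]
     bounding [z] becomes the horizontal part bounding [z']. *)
  have [t Et] : exists t, Sd t = z' - Smap (dP q) u.
    apply: acyclic; rewrite (linB (@Sd_lin _ _ _ _)) -E Ez Sd_Smap.
    by rewrite (linD (@Smap_lin _ _ _ (dP q) _ _)) dPdP addr0 subrr.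
  by exists t, u; rewrite Et subrK.
have [t Et] : exists t, Smap (dP q.+1) t = z - Sd w.
  apply/dPP; rewrite (linB (@Smap_lin _ _ _ (dP q) _ _)) E Ez -Sd_Smap.
  by rewrite (linD (@Sd_lin _ _ _ _)) SdSd add0r subrr.
by exists w, t; rewrite Et addrC subrK.
Qed.

(** By exactness at [P 0], the differential of [z] comes from [P 1] exactly when the image of [z]
    under [eps] is a cycle. *)
Lemma corner_last p : SQ_rel (corner 0 p) (Stilde_homology V p).
Proof.
have colP n (z : Sc (P 0) p n) : col_liftable z <-> SK (Smap eps z).
  by case: p z => //= p z; rewrite Sd_Smap; split=> [H|/epsP//]; apply/epsP.
exists (fun n (z : Sc (P 0) p n) (y : Sc V p n) => col_liftable z /\ Smap eps z = y).
split; first split.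
- by move=> n z y [/[dup] zc /colP zK <-].
- move=> n c x y x' y' [xc <-] [xc' <-]; rewrite (Smap_lin eps); split=> //.
  case: p x x' xc xc' {y y' colP} => //= p x x' [u Eu] [u' Eu']; exists (c *: u + u').
  by rewrite (Smap_lin (dP 0%N)) Sd_lin Eu Eu'.
- move=> m n f x y fI [xc <-]; rewrite /= -Sact_Smap //; split=> //.
  case: p x xc {y colP} => //= p x [u Eu]; exists (Sact n f u).
  by rewrite -Sact_Smap // Eu Sd_Sact.
- by move=> n z [_ zc]; exists (Smap eps z).
- move=> n y yK; have [z Ez] := Smap_surj y resP.2.1; exists z; split=> //.
  by apply/colP; rewrite Ez.
move=> n z y [_ <-]; split=> [[u [w ->]]|[t Et]].
  have e0 : Smap eps (Smap (dP 0%N) w) = 0 by apply/epsP; exists w.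
  by exists (Smap eps u); rewrite (linD (@Smap_lin _ _ _ eps _ _)) e0 addr0 Sd_Smap.
have [u Eu] := Smap_surj t resP.2.1.
have [w Ew] : exists w, Smap (dP 0%N) w = z - Sd u.
  by apply/epsP; rewrite (linB (@Smap_lin _ _ _ eps _ _)) -Sd_Smap Eu Et subrr.
by exists u, w; rewrite Ew addrC subrK.
Qed.

(** By [inJ_Sd], boundaries in degree 0 are the elements of JP, so liftability along the row says
    that [x] is a cycle of P/JP. *)
Lemma corner_first a : SQ_rel (FIhomology dP a) (corner a 0).
Proof.
have rowP n (x : Mc (P a) n) : row_liftable (emb0 x) <-> FIhomK dP x.
  by case: a x => //= a x; rewrite Smap_emb0 -inJ_Sd.
exists (fun n (x : Mc (P a) n) (z : Sc (P a) 0 n) => FIhomK dP x /\ emb0 x = z).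
split; first split.
- by move=> n x z [/[dup] xK /rowP xr <-].
- move=> n c x y x' y' [xK <-] [xK' <-]; rewrite emb0_lin; split=> //.
  case: a x x' xK xK' {y y' rowP} => //= a x x' xK xK'; rewrite hlin.
  by apply: inJadd => //; apply: inJscale.
- move=> m n f x y fI [xK <-]; rewrite /= Sact_emb0 //; split=> //.
  apply/rowP; rewrite -Sact_emb0 //; move/rowP: xK.
  case: a x {y rowP} => //= a x [u Eu]; exists (Sact n f u).
  by rewrite -Sact_Smap // -Eu Sd_Sact.
- by move=> n x xK; exists (emb0 x).
- move=> n z [zr _]; exists (proj0 z); rewrite proj0K; split=> //.
  by apply/rowP; rewrite proj0K.
move=> n x z [_ <-]; split=> [[y [j [jJ ->]]]|[u [w E]]].
  have [t Et] := (inJ_Sd j).1 jJ; exists t, (emb0 y).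
  by rewrite (linD (@emb0_lin _ _ _)) Smap_emb0 Et addrC.
exists (proj0 w), (x - hmap (dP a) (proj0 w)); split; last by rewrite addrC subrK.
apply/inJ_Sd; exists u; rewrite (linB (@emb0_lin _ _ _)) -Smap_emb0 proj0K.
by rewrite E addrK.
Qed.

Lemma corner_homology q p : SQ_rel (corner q p) (Stilde_homology V (q + p)).
Proof.
elim: q p => [|q IH] p; first exact: corner_last.
by apply: SQ_rel_trans (corner_step q p) _; rewrite addSnnS; apply: IH.
Qed.

Lemma FIhomology_iso a : SQ_iso (FIhomology dP a) (Stilde_homology V a).
Proof.
apply: SQ_rel_iso => [n x [y [j [jJ ->]]]|n|].
- case: a {x} y j jJ => //= a y j jJ; rewrite (linD (@hmap_lin _ _ _ (dP a) _)).
  have -> : hmap (dP a) (hmap (dP a.+1) y) = 0 by apply/resP.2.2.2; exists y.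
  by rewrite add0r; apply: inJ_hmap.
- exists 0, 0; split; first exact: inJ0.
  by rewrite (lin0 (@hmap_lin _ _ _ (dP a) _)) addr0.
by rewrite -[in Stilde_homology V a](addn0 a);
  apply: SQ_rel_trans (corner_first a) (corner_homology a 0).
Qed.

End Resolution.

Local Close Scope ring_scope.

Theorem theorem1p1 (R : comPzRingType) (V : FImod R)
    (P : nat -> FImod R) (dP : forall a, FIhom (P a.+1) (P a)) (eps : FIhom (P 0) V) :
  is_proj_resolution dP eps ->
  forall a : nat, SQ_iso (FIhomology dP a) (Stilde_homology V a).
Proof. exact: FIhomology_iso. Qed.
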